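(* For any $h\in(0,\bar h]$, the function $I\ni y\mapsto\hat a_h(y)$ is Lipschitz continuous on $I$ with Lipschitz constant $1$, i.e., $$|\hat a_h(y_1)-\hat a_h(y_2)|\le|y_1-y_2|\quad\text{for all }y_1,y_2\in I\text{ and }h\in(0,\bar h].$$ Moreover, there exists a constant $C_0\in[0,\infty)$ such that $$\hat a_h(y)\le C_0+|y|\quad\text{for all }y\in I\text{ and }h\in(0,\bar h].$$
   Context: Let $Y=(Y_t)_{t\ge0}$ be a one-dimensional continuous strong Markov process (in the sense of Revuz--Yor, Section VII.3) with laws $(P_y)_{y\in I}$, $P_y[Y_0=y]=1$. Its state space $I\subseteq\mathbb R$ is an open, half-open or closed interval with interior $I^\circ=(l,r)$, $-\infty\le l<r\le\infty$; put $\bar I=[l,r]$. Let $H_x(Y)=\inf\{t\ge0:Y_t=x\}$. Standing assumptions: $Y$ is regular ($P_y[H_x(Y)<\infty]>0$ for all $y\in I^\circ$, $x\in I$), conservative (infinite life time) and in natural scale. Let $m$ be the speed measure of $Y$ on $I^\circ$ (normalized so that Brownian motion has $m(dx)=2\,dx$); recall that $0<m([a,b])<\infty$ for all $a<b$ in $I^\circ$. A boundary point $b\in\{l,r\}$ is called accessible if $P_y[H_b(Y)<\infty]>0$ for some (equivalently all) $y\in I^\circ$; $b$ is accessible if and only if $b\in I$, and accessible boundary points are assumed absorbing. By Feller's test, $l\in I$ if and only if $l>-\infty$ and $\int_{(l,y)}(u-l)\,m(du)<\infty$ for some (equivalently all) $y\in I^\circ$, and symmetrically for $r$. Fix $\bar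 h\in(0,\infty)$. For $h\in(0,\bar h]$ the EMCEL scale factor $\hat a_h\colon\bar I\to[0,\infty)$ is defined by $\hat a_h(l)=\hat a_h(r)=0$ and, for $y\in I^\circ$, $$\hat a_h(y)=\sup\Big\{a\ge0:\ y\pm a\in I\ \text{ and }\ \tfrac12\int_{(y-a,y+a)}(a-|u-y|)\,m(du)\le h\Big\}.$$ *)

(* Defs.v *)
From HB Require Import structures.
From mathcomp Require Import all_boot all_order all_algebra.
From mathcomp Require Import all_classical all_reals all_analysis.
From mathcomp Require Import measurable_realfun.

Set Implicit Arguments.
Unset Strict Implicit.
Unset Printing Implicit Defensive.

Import Order.TTheory GRing.Theory Num.Theory.
Import numFieldNormedType.Exports.

Local Open Scope classical_set_scope.
Local Open Scope ring_scope.

(* Processes are maps [Y : R -> T -> R]; only times [t >= 0] are ever used.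
   Laws are maps [P : R -> probability T R]; only [P y] with [y] in the state
   space [I] is ever used. *)

Section StateSpace.
Variable R : realType.

Definition open_itv (l r : \bar R) : set R :=
  [set x | (l < x%:E)%E /\ (x%:E < r)%E].

Definition closed_itv (l r : \bar R) : set R :=
  [set x | (l <= x%:E)%E /\ (x%:E <= r)%E].

(* The inclusions leave exactly the choice of which finite endpoints belong
   to [I]. *)
Definition state_space (l r : \bar R) (I : set R) : Prop :=
  [/\ (l < r)%E, open_itv l r `<=` I & I `<=` closed_itv l r].

End StateSpace.

Section Process.
Context {d : measure_display} {T : measurableType d} {R : realType}.
Implicit Types (Y : R -> T -> R) (P : R -> probability T R) (I : set R).

Definition hitting_time Y (x : R) (w : T) : \bar R :=
  ereal_inf [set t%:E | t in [set t : R | 0 <= t /\ Y t w = x]].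

Definition natural_filtration Y (t : R) : set (set T) :=
  <<s [set A | exists (s : R) (B : set R),
         [/\ 0 <= s <= t, measurable B & A = Y s @^-1` B]] >>.

(* Stopping times of the right-continuous filtration
   F_(t+) = \bigcap_(s > t) F_s. *)
Definition optional_time Y (tau : T -> \bar R) : Prop :=
  (forall w, 0 <= tau w)%E /\
  forall t : R, 0 <= t ->
    natural_filtration Y t [set w | (tau w < t%:E)%E].

Definition optional_event Y (tau : T -> \bar R) (A : set T) : Prop :=
  forall t : R, 0 <= t ->
    natural_filtration Y t (A `&` [set w | (tau w < t%:E)%E]).

Definition path_events : set (set (R -> R)) :=
  <<s [set C | exists (s : R) (B : set R),
         [/\ 0 <= s, measurable B & C = [set f | B (f s)]]] >>.

(* The law of the path after [tau], given the events up to [tau+], is the law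
   of the process started at [Y_tau], on the event [tau < +oo]. *)
Definition strong_markov I Y P : Prop :=
  forall (y : R) (tau : T -> \bar R) (A : set T) (C : set (R -> R)),
    I y -> optional_time Y tau -> optional_event Y tau A -> path_events C ->
    P y (A `&` [set w | (tau w < +oo)%E]
           `&` [set w | C (fun s => Y (fine (tau w) + s) w)]) =
    (\int[P y]_(w in A `&` [set w | (tau w < +oo)%E])
        P (Y (fine (tau w)) w) [set w' | C (fun s => Y s w')])%E.

(* That [Y] stays in [I] at all times is the assumption of infinite life
   time. *)
Record continuous_strong_markov I Y P : Prop := {
  csm_measurable : forall t : R, 0 <= t -> measurable_fun setT (Y t) ;
  csm_conservative : forall (t : R) w, 0 <= t -> I (Y t w) ;
  csm_continuous : forall w, {within [set t : R | 0 <= t],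
                                continuous (fun t => Y t w)} ;
  csm_start : forall y, I y -> P y [set w | Y 0 w = y] = 1%E ;
  csm_kernel : forall C, path_events C ->
    measurable_fun I (fun y => P y [set w | C (fun s => Y s w)]) ;
  csm_strong_markov : strong_markov I Y P }.

Definition regular_process (l r : \bar R) I Y P : Prop :=
  forall y x, open_itv l r y -> I x ->
    (0 < P y [set w | (hitting_time Y x w < +oo)%E])%E.

Definition natural_scale I Y P : Prop :=
  forall a b y, I a -> I b -> a < y < b ->
    P y [set w | (hitting_time Y b w < hitting_time Y a w)%E] =
    ((y - a) / (b - a))%:E.

(* A boundary point is accessible if and only if it belongs to [I]. *)
Definition absorbing_boundary (l r : \bar R) I Y P : Prop :=
  forall b, I b -> b%:E = l \/ b%:E = r ->
    P b [set w | forall t : R, 0 <= t -> Y t w = b] = 1%E.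

(* Green function of the interval ]a, b[ in natural scale. *)
Definition green (a b y u : R) : R :=
  if y <= u then (y - a) * (b - u) / (b - a)
  else (u - a) * (b - y) / (b - a).

(* [m] represents a measure on the open interval ]l, r[; its values outside
   of ]l, r[ are irrelevant.  For Brownian motion the exit time of ]a, b[ has
   expectation (y - a) * (b - y), so that this normalization of the Green
   function gives m(du) = 2 du. *)
Definition speed_measure (l r : \bar R) I Y P
    (m : {measure set (measurableTypeR R) -> \bar R}) : Prop :=
  (forall a b, open_itv l r a -> open_itv l r b -> (m `[a, b]%classic < +oo)%E) /\
  (forall a b y, I a -> I b -> a < y < b ->
     (\int[P y]_w mine (hitting_time Y a w) (hitting_time Y b w) =
      \int[m]_(u in `]a, b[%classic) (green a b y u)%:E)%E).

End Process.

Section Emcel.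
Variable R : realType.

(* The set below contains 0 and, when [m] is a speed measure, is bounded
   above, since [m] charges every nonempty open subinterval of ]l, r[. *)
Definition emcel_scale (l r : \bar R) (I : set R)
    (m : {measure set (measurableTypeR R) -> \bar R}) (h : R)
    (y : \bar R) : R :=
  if ((l < y) && (y < r))%E then
    let x := fine y in
    sup [set a : R | [/\ 0 <= a, I (x - a), I (x + a) &
      ((2^-1)%:E * \int[m]_(u in `](x - a)%R, (x + a)%R[%classic)
                      (a - `|u - x|)%:E <= h%:E)%E]]
  else 0.

End Emcel.

(* Main.v *)
(* If [a] is admissible at [y1], then so is [a - |y1 - y2|] at [y2]: the tent
   of half-width [a - |y1 - y2|] centred at [y2] lies below the tent of
   half-width [a] centred at [y1].  Linear growth then follows from the
   Lipschitz bound at one reference point, since the scale factor is monotone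
   in [h].  Scaling of tents shows that the admissible sets for the different
   [h] and [y] are either all bounded or all unbounded; in the latter case
   every [sup] has the junk value 0. *)
Require Import Defs.
From mathcomp Require Import all_boot all_order all_algebra.
From mathcomp Require Import all_classical all_reals all_analysis.
From mathcomp Require Import measurable_realfun.
From mathcomp Require Import ring lra.

Set Implicit Arguments.
Unset Strict Implicit.
Unset Printing Implicit Defensive.

Import Order.TTheory GRing.Theory Num.Theory.
Import numFieldNormedType.Exports.

Local Open Scope classical_set_scope.
Local Open Scope ring_scope.

Section StateSpaceConvexity.
Variables (R : realType) (l r : \bar R) (I : set R).
Hypothesis hI : state_space l r I.

(** A point strictly between two points of [I] lies strictly between [l] and [r], and [I] contains
    all such points. *)
Lemma state_space_convex (p q x : R) : I p -> I q -> p <= x <= q -> I x.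
Proof.
case: hI => _ oI Icl Ip Iq; rewrite !le_eqVlt.
case/andP=> /orP[/eqP<- //|px] /orP[/eqP-> //|xq].
have [lp _] := Icl _ Ip; have [_ qr] := Icl _ Iq.
by apply: oI; split; [apply: le_lt_trans lp _|apply: lt_le_trans qr];
  rewrite lte_fin.
Qed.

Lemma state_space_boundary (y : R) : I y -> ~ open_itv l r y ->
  y%:E = l \/ y%:E = r.
Proof.
case: hI => _ _ Icl /Icl[ly yr] ny.
have [yl|nyl] := eqVneq y%:E l; first by left.
have [yr'|nyr] := eqVneq y%:E r; first by right.
by case: ny; split; rewrite lt_neqAle ?ly ?yr ?nyr // eq_sym nyl.
Qed.

End StateSpaceConvexity.

Section TentIntegral.
Variables (R : realType) (m : {measure set (measurableTypeR R) -> \bar R}).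

Definition tent_integral (x a : R) : \bar R :=
  (\int[m]_(u in `](x - a)%R, (x + a)%R[%classic) (a - `|u - x|)%:E)%E.

Lemma in_itv_ball (x a u : R) :
  (`](x - a), (x + a)[%classic : set R) u <-> `|u - x| < a.
Proof. by rewrite /= in_itv /= ltr_distl. Qed.

Lemma measurable_tent (x a : R) (D : set (measurableTypeR R)) :
  measurable_fun D (fun u : measurableTypeR R => (a - `|u - x|)%:E).
Proof.
apply/measurable_EFinP; apply: measurable_funB; first exact: measurable_cst.
apply: measurableT_comp; first exact: normr_measurable.
by apply: measurable_funB; [exact: measurable_id|exact: measurable_cst].
Qed.

(** On the first interval the left side of the hypothesis is positive, which forces that interval
    into the second one; the rest of the second interval only adds a nonnegative amount. Shifting
    uses [t = 1], scaling uses [t = k / h]. *)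
Lemma le_tent_integral (t x a y b : R) : 0 < t ->
  (forall u, `|u - x| < a -> t * (a - `|u - x|) <= b - `|u - y|) ->
  (t%:E * tent_integral x a <= tent_integral y b)%E.
Proof.
move=> t0 tent_le.
have sub : (`](x - a)%R, (x + a)%R[%classic : set (measurableTypeR R))
    `<=` `](y - b)%R, (y + b)%R[%classic.
  move=> u /in_itv_ball ua; apply/in_itv_ball.
  rewrite -subr_gt0; apply: lt_le_trans (tent_le u ua).
  by rewrite mulr_gt0 // subr_gt0.
rewrite /tent_integral -ge0_integralZl //=; last 3 first.
- exact: measurable_tent.
- by move=> u /in_itv_ball ua; rewrite lee_fin subr_ge0 ltW.
- by rewrite lee_fin ltW.
apply: (@le_trans _ _
  (\int[m]_(u in `](x - a)%R, (x + a)%R[%classic) (b - `|u - y|)%:E)%E).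
  apply: ge0_le_integral => //=.
  - move=> u /in_itv_ball ua; rewrite -EFinM lee_fin.
    by rewrite mulr_ge0 ?subr_ge0 // ltW.
  - by apply: measurable_funeM; exact: measurable_tent.
  - exact: measurable_tent.
  - by move=> u /in_itv_ball ua; rewrite -EFinM lee_fin tent_le.
apply: ge0_subset_integral => //=; first exact: measurable_tent.
by move=> u /in_itv_ball ub; rewrite lee_fin subr_ge0 ltW.
Qed.

End TentIntegral.

Section EmcelSet.
Variables (R : realType) (l r : \bar R) (I : set R).
Variable m : {measure set (measurableTypeR R) -> \bar R}.
Hypothesis hI : state_space l r I.
Implicit Types h k x y a : R.

Definition emcel_set h x : set R :=
  [set a : R | [/\ 0 <= a, I (x - a), I (x + a) &
    ((2^-1)%:E * tent_integral m x a <= h%:E)%E]].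

Lemma emcel_scale_in h x : open_itv l r x ->
  emcel_scale l r I m h x%:E = sup (emcel_set h x).
Proof. by move=> [lx xr]; rewrite /emcel_scale lx xr. Qed.

Lemma emcel_scale_notin h x : ~ open_itv l r x ->
  emcel_scale l r I m h x%:E = 0.
Proof. by move=> nx; rewrite /emcel_scale; case: ifP => // /andP xI; case: nx. Qed.

Lemma emcel_set0 h x : 0 <= h -> I x -> emcel_set h x 0.
Proof.
move=> h0 Ix; split; rewrite ?subr0 ?addr0 // /tent_integral.
by rewrite subr0 addr0 set_itvoo0 // integral_set0 mule0 lee_fin.
Qed.

Lemma emcel_set_shift h x y a : emcel_set h x a -> `|x - y| <= a ->
  emcel_set h y (a - `|x - y|).
Proof.
move=> [a0 Il Ir hle] xya.
have /andP[xy1 xy2] : - `|x - y| <= x - y <= `|x - y|.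
  by rewrite -ler_norml.
split; first by rewrite subr_ge0.
- by apply: (state_space_convex hI Il Ir); apply/andP; split; lra.
- by apply: (state_space_convex hI Il Ir); apply/andP; split; lra.
apply: le_trans hle; apply: lee_wpmul2l; first by rewrite lee_fin invr_ge0.
rewrite -[X in (X <= _)%E]mul1e; apply: le_tent_integral => // u _.
by have := ler_distD y u x; rewrite (distrC y x); lra.
Qed.

(* [a |-> tent_integral m x a] is convex and vanishes at 0, hence is
   superlinear. *)
Lemma emcel_set_scale h k x a : 0 < h <= k -> I x ->
  emcel_set k x a -> emcel_set h x (h / k * a).
Proof.
move=> /andP[h0 hk] Ix [a0 Il Ir kle].
have k0 : 0 < k := lt_le_trans h0 hk.
have c0 : 0 < h / k by rewrite divr_gt0.
have c1 : h / k <= 1 by rewrite ler_pdivrMr // mul1r.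
have ca0 : 0 <= h / k * a by rewrite mulr_ge0 // ltW.
have caa : h / k * a <= a by rewrite ler_piMl.
split=> //.
- by apply: (state_space_convex hI Il Ix); apply/andP; split; lra.
- by apply: (state_space_convex hI Ix Ir); apply/andP; split; lra.
have kh0 : 0 < k / h by rewrite divr_gt0.
(* Stretching the smaller tent vertically by [k / h] gives it the height [a] of the larger one, with
   steeper sides, so it stays below. *)
have tent_le : ((k / h)%:E * tent_integral m x (h / k * a)
    <= tent_integral m x a)%E.
  apply: le_tent_integral => // u _.
  have -> : k / h * (h / k * a - `|u - x|) = a - k / h * `|u - x|.
    by field; rewrite !gt_eqF.
  by rewrite lerD2l lerN2 ler_peMl // ler_pdivlMr // mul1r.
rewrite -(@lee_pmul2l _ (k / h)%:E) // ?lte_fin //.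
rewrite muleCA -EFinM divfK ?gt_eqF //; apply: le_trans kle.
by apply: lee_wpmul2l; rewrite ?lee_fin ?invr_ge0.
Qed.

(** An element [a] at [y] is either below [|y - x|] or can be shifted back to [x]; the maximum with
    0 covers the first case. *)
Lemma has_ubound_emcel_set_shift h x y :
  has_ubound (emcel_set h x) -> has_ubound (emcel_set h y).
Proof.
move=> [M Mub]; exists (Num.max 0 M + `|y - x|) => a ha.
rewrite -lerBlDr; have [ax|ax] := leP `|y - x| a.
  by rewrite le_max (Mub _ (emcel_set_shift ha ax)) orbT.
by rewrite le_max subr_le0 ltW.
Qed.

(** The set for [k] is the larger one, so inclusion is of no help; scaling by [h / k] maps it into
    the set for [h]. *)
Lemma has_ubound_emcel_set_scale h k x : 0 < h <= k -> I x ->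
  has_ubound (emcel_set h x) -> has_ubound (emcel_set k x).
Proof.
move=> hk Ix [M Mub]; exists (k / h * M) => a ka.
have /andP[h0 hk'] := hk; have k0 := lt_le_trans h0 hk'.
have := Mub _ (emcel_set_scale hk Ix ka).
by rewrite -(ler_pM2l (divr_gt0 k0 h0)) mulrA mulf_div (mulrC k) divff
  ?mul1r // mulf_neq0 // gt_eqF.
Qed.

Lemma emcel_scale_ge0 h x : 0 <= h -> I x ->
  0 <= emcel_scale l r I m h x%:E.
Proof.
move=> h0 Ix; have [ox|nox] := pselect (open_itv l r x); last first.
  by rewrite emcel_scale_notin.
rewrite emcel_scale_in //; have [ub|nub] := pselect (has_ubound (emcel_set h x)).
  exact: (ub_le_sup ub (emcel_set0 h0 Ix)).
(* Without an upper bound, [sup] is 0 by convention. *)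
by rewrite sup_out // => -[].
Qed.

Lemma emcel_scale_le_dist h x y : 0 <= h -> I x -> I y ->
  emcel_scale l r I m h x%:E <= emcel_scale l r I m h y%:E + `|x - y|.
Proof.
move=> h0 Ix Iy; have sy0 := emcel_scale_ge0 h0 Iy.
have [ox|nox] := pselect (open_itv l r x); last first.
  by rewrite emcel_scale_notin // addr_ge0.
rewrite (emcel_scale_in _ ox).
have [ub|nub] := pselect (has_ubound (emcel_set h x)); last first.
  by rewrite sup_out ?addr_ge0 // => -[].
apply: ge_sup; first by exists 0; exact: emcel_set0.
move=> a ha; have [oy|noy] := pselect (open_itv l r y).
  (* A half-width below [|x - y|] cannot be shifted to [y], but then nonnegativity of the scale at
     [y] suffices. *)
  have [xya|axy] := leP `|x - y| a; last first.
    by apply: le_trans (ltW axy) _; rewrite lerDr.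
  rewrite -lerBlDr emcel_scale_in //; apply: ub_le_sup.
    exact: has_ubound_emcel_set_shift ub.
  exact: emcel_set_shift.
(* Here [y] is an endpoint of [I] with scale 0. Since [x - a] and [x + a] do not pass it, [a] is at
   most the distance from [x] to [y]. *)
rewrite emcel_scale_notin // add0r.
case: hI => _ _ Icl; case: ha => _ /Icl[lxa _] /Icl[_ xar] _.
case: (state_space_boundary hI Iy noy) => [yl|yr].
  move: lxa; rewrite -yl lee_fin lerBrDr => yax.
  by rewrite (le_trans _ (ler_norm _)) // lerBrDr addrC.
move: xar; rewrite -yr lee_fin => xay.
by rewrite distrC (le_trans _ (ler_norm _)) // lerBrDr addrC.
Qed.

Lemma emcel_scale_le h k x : 0 < h <= k -> I x ->
  emcel_scale l r I m h x%:E <= emcel_scale l r I m k x%:E.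
Proof.
move=> hk Ix; have /andP[h0 hk'] := hk.
have [ox|nox] := pselect (open_itv l r x); last first.
  by rewrite !emcel_scale_notin.
have k0 : 0 <= k := le_trans (ltW h0) hk'.
(* Inclusion of the admissible sets orders the suprema only if the set for [k] is bounded, which
   follows from boundedness for [h]. *)
have [ub|nub] := pselect (has_ubound (emcel_set h x)); last first.
  rewrite (emcel_scale_in h) // sup_out; last by case.
  exact: emcel_scale_ge0.
rewrite !emcel_scale_in //; apply: ge_sup.
  by exists 0; apply: emcel_set0 => //; exact: ltW.
move=> a [a0 Il Ir hle]; apply: ub_le_sup.
  exact: has_ubound_emcel_set_scale ub.
by split=> //; apply: le_trans hle _; rewrite lee_fin.
Qed.

End EmcelSet.

Theorem corollary2p11 (R : realType) (d : measure_display)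
    (T : measurableType d) (l r : \bar R) (I : set R)
    (Y : R -> T -> R) (P : R -> probability T R)
    (m : {measure set (measurableTypeR R) -> \bar R}) (hbar : R)
    (hI : state_space l r I)
    (hY : continuous_strong_markov I Y P)
    (hreg : regular_process l r I Y P)
    (hscale : natural_scale I Y P)
    (habs : absorbing_boundary l r I Y P)
    (hm : speed_measure l r I Y P m)
    (hbar0 : 0 < hbar) :
  (forall h : R, 0 < h <= hbar -> forall y1 y2 : R, I y1 -> I y2 ->
     `| emcel_scale l r I m h y1%:E - emcel_scale l r I m h y2%:E |
       <= `| y1 - y2 |) /\
  (exists C0 : R, 0 <= C0 /\
     forall h : R, 0 < h <= hbar -> forall y : R, I y ->
       emcel_scale l r I m h y%:E <= C0 + `| y |).
Proof.
split=> [h /andP[/ltW h0 _] y1 y2 I1 I2|].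
  rewrite ler_distl; apply/andP; split.
    by rewrite lerBlDr distrC; exact: emcel_scale_le_dist.
  exact: emcel_scale_le_dist.
have [[y0 I0]|nI] := pselect (exists y0, I y0); last first.
  by exists 0; split=> // h _ y Iy; case: nI; exists y.
(* The scale at [y0] is largest for [h = hbar], and [|y - y0| <= |y0| + |y|] accounts for the second
   summand. *)
exists (emcel_scale l r I m hbar y0%:E + `|y0|); split.
  by rewrite addr_ge0 // emcel_scale_ge0 // ltW.
move=> h hh y Iy; have /andP[h0 _] := hh.
apply: le_trans (emcel_scale_le_dist m hI (ltW h0) Iy I0) _.
rewrite -addrA; apply: lerD; first exact: emcel_scale_le.
by rewrite addrC; exact: ler_normB.
Qed.
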